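(* There is a fixed constant $\delta>0$ such that the following holds. Given an $n$-node tree $T$ as an instance of CVRP (with positive integer edge weights bounded by a polynomial in $n$) and any fixed $\epsilon>0$, one can build a tree $T'$ on the same node set, with the same depot and demands, of height at most $\delta\log^2 n/\epsilon$, such that $\mathrm{opt}(T')\le\mathrm{opt}(T)\le(1+\epsilon)\,\mathrm{opt}(T')$, where $\mathrm{opt}(\cdot)$ denotes the optimum CVRP cost on the given tree.
   Context: CVRP on a tree: given a tree with nonnegative edge weights (shortest-path metric), a depot node $r$ (the root), a capacity $Q$, and demands on nodes, find a minimum-cost collection of tours starting and ending at $r$, each delivering at most $Q$ demand, that together deliver all demand. The height of a rooted tree is the maximum number of edges on a root-to-leaf path. Throughout, the paper assumes (after a standard preprocessing) that edge weights are positive integers bounded by a polynomial in $n$.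
   Formalization: One δ for all ε>0 is impossible: with n=2 nodes every tree has height 1, exceeding δlog²n/ε once ε>δlog²n. The formal theorem fixes an arbitrary upper bound on ε (and the polynomial) first, and δ is uniform over all n and all ε up to that bound. *)

(* Defs.v *)
From HB Require Import structures.
From mathcomp Require Import all_boot all_order all_algebra.
From mathcomp Require Import classical_sets reals.

Set Implicit Arguments.
Unset Strict Implicit.
Unset Printing Implicit Defensive.

Import Order.TTheory GRing.Theory Num.Theory.
Local Open Scope classical_set_scope.
Local Open Scope ring_scope.

(* Only the values of [weight] on edges are ever used.  [ucycle edge c] is also
   true of the back-and-forth [:: x; y] along one edge, so the genuine simple
   cycles of the graph are those of size at least 3. *)
Record wtree (R : realType) (V : finType) := WTree {
  edge : rel V;
  weight : V -> V -> R;
  edge_sym : symmetric edge;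
  edge_irr : irreflexive edge;
  edge_connected : forall x y : V, connect edge x y;
  edge_acyclic : forall c : seq V, ucycle edge c -> (size c <= 2)%N;
  weight_sym : forall x y : V, edge x y -> weight x y = weight y x;
  weight_ge0 : forall x y : V, edge x y -> 0 <= weight x y
}.

(* f x p_1 + f p_1 p_2 + ... + f p_(k-1) p_k *)
Definition path_sum (R : realType) (V : finType) (f : V -> V -> R)
    (x : V) (p : seq V) : R :=
  \sum_(a <- zip (x :: p) p) f a.1 a.2.

Definition dist (R : realType) (V : finType) (T : wtree R V) (x y : V) : R :=
  inf [set path_sum (weight T) x p | p in
        [set p : seq V | path (edge T) x p /\ last x p = y]].

(* A leaf is a node without children: its degree is 0 if it is the root, and 1
   (the edge to its parent) otherwise; the boolean is coerced to nat. *)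
Definition leaf (R : realType) (V : finType) (T : wtree R V) (r v : V) : bool :=
  #|edge T v| == (v != r) :> nat.

(* A simple path has fewer than #|V| edges, whence the range of k. *)
Definition height (R : realType) (V : finType) (T : wtree R V) (r : V) : nat :=
  \max_(k < #|V| | [exists p : k.-tuple V,
      [&& path (edge T) r p, uniq (r :: p) & leaf T r (last r p)]]) k.

(* The tour goes from the depot through the nodes of [stops t], in that order,
   and back to the depot; [deliver t v] is the amount delivered at v. *)
Notation tour V := (seq V * {ffun V -> nat})%type.

Definition stops (V : finType) (t : tour V) : seq V := t.1.

Definition deliver (V : finType) (t : tour V) (v : V) : nat := t.2 v.

Definition tour_ok (V : finType) (r : V) (Q : nat) (t : tour V) : Prop :=
  (forall v : V, (0 < deliver t v)%N -> v \in r :: stops t) /\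
  (\sum_v deliver t v <= Q)%N.

Definition tour_cost (R : realType) (V : finType) (T : wtree R V) (r : V)
    (t : tour V) : R :=
  path_sum (dist T) r (rcons (stops t) r).

(* The demand of a node may be split among several tours. *)
Definition solution (V : finType) (r : V) (Q : nat) (demand : V -> nat)
    (S : seq (tour V)) : Prop :=
  (forall t, t \in S -> tour_ok r Q t) /\
  (forall v : V, (\sum_(t <- S) deliver t v)%N = demand v).

(* For 0 < Q the set of costs is nonempty and bounded below by 0. *)
Definition opt (R : realType) (V : finType) (T : wtree R V) (r : V) (Q : nat)
    (demand : V -> nat) : R :=
  inf [set \sum_(t <- S) tour_cost T r t | S in
        [set S : seq (tour V) | solution r Q demand S]].

(* Main.v *)
Require Import Defs.
From HB Require Import structures.
From mathcomp Require Import all_boot all_order all_algebra.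
From mathcomp Require Import boolp classical_sets reals exp.
From mathcomp Require Import zify ring lra.
Import Order.TTheory GRing.Theory Num.Theory.
Local Open Scope ring_scope.

Set Implicit Arguments.
Unset Strict Implicit.
Unset Printing Implicit Defensive.

(* Root T at r, call a child v of a node u != r heavy when its subtree contains
   more than half of that of u, and cut T into heavy paths: a root-to-node path
   meets O(log n) of them.  For v on a heavy path H let l(v) be the distance to v
   from the parent of the top of H.  A tour costs at least twice the weight of
   the subtree spanned by its stops and the root, and an Euler tour attains this;
   that subtree meets H in a prefix, so its weight is the sum over the heavy
   paths of l at the deepest node reached.  Hence rounding every l(v) down to a
   power rho(v) of 1 + eps changes the optimum by a factor at most 1 + eps.
   After rounding, only the nodes where rho jumps along H (the hubs, O(log n/eps)
   per heavy path) have an edge of positive weight to their parent, so every node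
   can be hung from its nearest proper ancestor that is a hub: this leaves the
   weights of all the cuts between a subtree of T and its complement unchanged. *)

(** * Trees given by a parent map *)

Definition parent_edge (V : finType) (r : V) (p : V -> V) : rel V :=
  fun x y => (x != r) && (p x == y) || (y != r) && (p y == x).

(** [dep] need not be the depth: any measure decreasing strictly towards r excludes cycles of [p],
    so one measure can serve both T and the rehung tree. *)
Definition rooted (V : finType) (r : V) (p : V -> V) (dep : V -> nat) : Prop :=
  p r = r /\ forall v, v != r -> (dep (p v) < dep v)%N.

Section ParentTree.
Context (V : finType) (r : V) (p : V -> V) (dep : V -> nat).
Hypothesis rootedp : rooted r p dep.

Lemma rooted_root : p r = r. Proof. by case: rootedp. Qed.
Lemma rooted_dep v : v != r -> (dep (p v) < dep v)%N.
Proof. by case: rootedp => _; apply. Qed.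

Lemma rooted_ind (P : V -> Prop) :
  P r -> (forall v, v != r -> P (p v) -> P v) -> forall v, P v.
Proof.
move=> Pr PS v; have [n] := ubnP (dep v); elim: n v => // n IHn v lt_v.
have [->//|v_r] := eqVneq v r; apply: PS => //; apply: IHn.
by apply: leq_trans (rooted_dep v_r) _.
Qed.

Lemma parent_neq v : v != r -> p v != v.
Proof. by move=> v_r; apply: contraTneq (rooted_dep v_r) => ->; rewrite ltnn. Qed.

(** [fconnect p x u] encodes that u is x or an ancestor of x. *)
Lemma fconnect_leq (g : V -> nat) x u :
  (forall v, v != r -> (g (p v) <= g v)%N) -> fconnect p x u -> (g u <= g x)%N.
Proof.
move=> g_mono /iter_findex <-; elim: (findex p x u) => //= n /(leq_trans _).
apply; set v := iter n p x; have [->|/g_mono//] := eqVneq v r.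
by rewrite rooted_root.
Qed.

Lemma fconnect_dep x u : fconnect p x u -> (dep u <= dep x)%N.
Proof. by apply: fconnect_leq => v /rooted_dep/ltnW. Qed.

Lemma fconnect_step x u : x != u -> fconnect p x u = fconnect p (p x) u.
Proof. by move=> xu; rewrite fconnect_eqVf (negPf xu). Qed.

Lemma fconnect_rootE u : fconnect p r u = (u == r).
Proof.
apply/idP/eqP => [|->//] /iter_findex <-.
by elim: (findex _ _ _) => // n IHn; rewrite iterSr rooted_root.
Qed.

Lemma parent_edge_sym : symmetric (parent_edge r p).
Proof. by move=> x y; rewrite /parent_edge orbC. Qed.

Lemma parent_edge_irr : irreflexive (parent_edge r p).
Proof.
by move=> x; rewrite /parent_edge orbb; apply/andP=> -[/parent_neq/negPf->].
Qed.

Lemma parent_edge_connected x y : connect (parent_edge r p) x y.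
Proof.
have toroot v : connect (parent_edge r p) v r.
  elim/rooted_ind: v => // v v_r; apply: connect_trans.
  by apply: connect1; rewrite /parent_edge v_r eqxx.
apply: connect_trans (toroot x) _.
by rewrite (sym_connect_sym parent_edge_sym) toroot.
Qed.

Lemma parent_edge_leq_dep x y :
  parent_edge r p x y -> (dep y <= dep x)%N -> p x = y.
Proof.
case/orP=> /andP[nr /eqP<-] // le_xy.
by have := rooted_dep nr; rewrite ltnNge le_xy.
Qed.

(* Both neighbours on the cycle of a node of maximal depth are its parent. *)
Lemma parent_edge_acyclic (c : seq V) :
  ucycle (parent_edge r p) c -> (size c <= 2)%N.
Proof.
case: c => // x0 c /andP[cyc uc].
case: (arg_maxnP (P := mem (x0 :: c)) dep (mem_head x0 c)) => x xc maxx.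
have {}maxx y : y \in x0 :: c -> (dep y <= dep x)%N by apply: maxx.
case: (rot_to xc) => i s def_c.
have mem_s y : y \in x :: s -> y \in x0 :: c by rewrite -def_c mem_rot.
rewrite -(rot_cycle i) def_c in cyc; rewrite -(rot_uniq i) def_c in uc.
rewrite -(size_rot i) def_c.
case: s {def_c} cyc uc mem_s => [|y s] //; case/lastP: s => [|s z] // cyc uc mem_s.
have py : p x = y.
  apply: parent_edge_leq_dep; last by apply/maxx/mem_s; rewrite !inE eqxx orbT.
  by move: cyc => /=/andP[].
have pz : p x = z.
  apply: parent_edge_leq_dep.
    rewrite parent_edge_sym; move: cyc => /=/andP[_].
    by rewrite rcons_path last_rcons => /andP[].
  by apply/maxx/mem_s; rewrite !inE mem_rcons mem_head !orbT.
by move: uc; rewrite -py pz /= mem_rcons mem_head andbF.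
Qed.

(** After a step down, the parent of the current node is the node just left, so a simple path that
    has started downwards can never climb. *)
Lemma parent_path_down x s :
  path (parent_edge r p) x s -> uniq (x :: s) -> p x \notin s ->
  path (fun a b => (b != r) && (p b == a)) x s.
Proof.
elim: s x => //= y s IHs x /andP[exy es] /andP[xs us] pxs.
case/orP: exy => /andP[nr /eqP eq_p]; first by rewrite eq_p mem_head in pxs.
rewrite nr eq_p eqxx /=; apply: IHs => //; rewrite eq_p.
by apply: contra xs; rewrite inE => ->; rewrite orbT.
Qed.

Definition parent_tree_weight (R : realType) (w : V -> R) x y :=
  if (x != r) && (p x == y) then w x else w y.

(** Transparent, because later proofs compute its edges and weights. *)
Definition parent_tree (R : realType) (w : V -> R)
  (w_ge0 : forall v, v != r -> 0 <= w v) : wtree R V.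
Proof.
exists (parent_edge r p) (parent_tree_weight w).
- exact: parent_edge_sym.
- exact: parent_edge_irr.
- exact: parent_edge_connected.
- exact: parent_edge_acyclic.
- move=> x y; rewrite /parent_edge /parent_tree_weight.
  case: ifP => [/andP[x_r /eqP <-] _|_ /= ->] //.
  case: ifP => // /andP[px_r /eqP eqx].
  have := ltn_trans (rooted_dep px_r) (rooted_dep x_r).
  by rewrite eqx ltnn.
- move=> x y; rewrite /parent_edge /parent_tree_weight.
  by case: ifP => [/andP[x_r _] _|_ /= /andP[y_r _]]; apply: w_ge0.
Defined.

(** A simple path from the root only descends, and each step down raises the potential [h] by at
    least 1. *)
Lemma height_parent_tree (R : realType) (w : V -> R)
    (w_ge0 : forall v, v != r -> 0 <= w v) (h : V -> nat) (B : nat) :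
  (forall v, v != r -> (h (p v) < h v)%N) -> (forall v, (h v <= B)%N) ->
  (height (parent_tree w_ge0) r <= B)%N.
Proof.
move=> h_lt h_le; apply/bigmax_leqP => k /existsP[t /and3P[et ut _]].
have {et ut} : path (fun a b => (b != r) && (p b == a)) r t.
  apply: parent_path_down => //; rewrite rooted_root.
  by case/andP: ut.
have size_h s x : path (fun a b => (b != r) && (p b == a)) x s ->
    (h x + size s <= h (last x s))%N.
  elim: s x => [|y s IHs] x /=; first by rewrite addn0.
  case/andP=> /andP[y_r /eqP <-] /IHs; apply: leq_trans.
  by rewrite addnS -addSn leq_add2r h_lt.
move/size_h; rewrite size_tuple => /(leq_trans (leq_addl _ _)) /leq_trans.
exact.
Qed.

End ParentTree.

(** * Rooting an arbitrary tree *)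

(** [dep v] is the least number of edges from r to v, and [p v] precedes v on such a shortest path.
    Acyclicity leaves no other edges. *)
Lemma wtree_parent (R : realType) (V : finType) (T : wtree R V) (r : V) :
  exists (p : V -> V) (dep : V -> nat),
    rooted r p dep /\ edge T =2 parent_edge r p.
Proof.
pose reach v k := [exists t : k.-tuple V, path (edge T) r t && (last r t == v)].
have reach_ex v : exists k, reach v k.
  have /connectP[s es ->] := edge_connected T r v.
  by exists (size s); apply/existsP; exists (in_tuple s); rewrite es /=.
pose dep v := ex_minn (reach_ex v).
have dep_le s : path (edge T) r s -> (dep (last r s) <= size s)%N.
  move=> es; rewrite /dep; case: ex_minnP => k _; apply.
  by apply/existsP; exists (in_tuple s); rewrite es /=.
have dep_path v : exists s, [/\ path (edge T) r s, last r s = v & size s = dep v].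
  rewrite /dep; case: ex_minnP => k /existsP[t /andP[et /eqP lt]] _.
  by exists t; rewrite size_tuple.
have parentP v : exists u, if v == r then u = r
    else edge T u v /\ dep v = (dep u).+1.
  have [_|v_r] := eqVneq v r; first by exists r.
  have [s []] := dep_path v; case/lastP: s => [|s z].
    by move=> _ /= eq_r; rewrite -eq_r eqxx in v_r.
  rewrite rcons_path last_rcons size_rcons => /andP[es ez] eqz dv; subst z.
  exists (last r s); split => //; apply/eqP; rewrite eqn_leq; apply/andP; split.
    have [s' [es' ls' <-]] := dep_path (last r s).
    have := dep_le (rcons s' v); rewrite rcons_path last_rcons size_rcons es' ls'.
    exact.
  by rewrite -dv ltnS dep_le.
have [p pP] := choice parentP.
have pr : p r = r by have := pP r; rewrite eqxx.
have {pP}pP v : v != r -> edge T (p v) v /\ dep v = (dep (p v)).+1.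
  by move=> /negPf v_r; have := pP v; rewrite v_r.
have rootedp : rooted r p dep.
  by split => // v /pP[_ ->].
exists p, dep; split => // x y.
apply/idP/idP => [exy|/orP[]/andP[nr /eqP<-]]; last first.
- by case: (pP _ nr).
- by rewrite edge_sym; case: (pP _ nr).
apply/negPn/negP => npar.
pose e' := [rel a b | edge T a b && ~~ ((a == x) && (b == y) || (a == y) && (b == x))].
have e'_sym : symmetric e'.
  by move=> a b /=; rewrite edge_sym orbC [(b == x) && _]andbC [(b == y) && _]andbC.
(* Since [x y] is not a parent edge, all parent edges survive its removal, and
   a path from x to y through the root closes a cycle with it. *)
have toroot v : connect e' v r.
  elim/(rooted_ind rootedp): v => // v v_r; apply: connect_trans.
  apply: connect1 => /=; have [epv _] := pP _ v_r; rewrite edge_sym epv /=.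
  apply: contra npar => /orP[]/andP[/eqP eq1 /eqP eq2]; rewrite /parent_edge -eq1 -eq2.
    by rewrite v_r eqxx.
  by rewrite v_r eqxx orbT.
have : connect e' x y.
  apply: connect_trans (toroot x) _.
  by rewrite (sym_connect_sym e'_sym) toroot.
case/connectP => s0 /shortenP[s es us _ ly].
have : ucycle (edge T) (x :: s).
  rewrite /ucycle us andbT /= rcons_path -ly edge_sym exy andbT.
  by apply: sub_path es => a b /andP[].
(* The cycle has at most two nodes: an empty [s] would make x y a loop, and a single node in [s]
   would use the removed edge. *)
move/edge_acyclic; case: s es us ly => [|z [|? ?]] //= es us ly.
  by rewrite ly edge_irr in exy.
by move: es; rewrite -ly !eqxx /= !andbF.
Qed.

(** * Path sums and distances *)

Section PathSum.
Context (R : realType) (V : finType).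
Implicit Types (f g : V -> V -> R) (x y : V) (s : seq V).

Lemma path_sum_nil f x : path_sum f x [::] = 0.
Proof. by rewrite /path_sum /= big_nil. Qed.

Lemma path_sum_cons f x y s : path_sum f x (y :: s) = f x y + path_sum f y s.
Proof. by rewrite /path_sum /= big_cons. Qed.

Lemma path_sum_cat f x s1 s2 :
  path_sum f x (s1 ++ s2) = path_sum f x s1 + path_sum f (last x s1) s2.
Proof.
elim: s1 x => [|y s1 IHs] x /=; first by rewrite path_sum_nil add0r.
by rewrite !path_sum_cons IHs addrA.
Qed.

Lemma le_path_sum (e : rel V) f g x s :
  (forall a b, e a b -> f a b <= g a b) -> path e x s ->
  path_sum f x s <= path_sum g x s.
Proof.
move=> le_fg; elim: s x => [|y s IHs] x /=; first by rewrite !path_sum_nil.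
by case/andP=> exy /IHs le_s; rewrite !path_sum_cons lerD ?le_fg.
Qed.

Lemma path_sum_triangle f x s :
  (forall a, f a a = 0) -> (forall a b c, f a c <= f a b + f b c) ->
  f x (last x s) <= path_sum f x s.
Proof.
move=> f0 f_tri; elim: s x => [|y s IHs] x /=; first by rewrite path_sum_nil f0.
by rewrite path_sum_cons (le_trans (f_tri x y _)) // lerD2l.
Qed.

Lemma path_sum_lin (I : finType) (P : pred I) (w : I -> R)
    (F : I -> V -> V -> R) x s :
  path_sum (fun a b => \sum_(i | P i) w i * F i a b) x s =
  \sum_(i | P i) w i * path_sum (F i) x s.
Proof.
elim: s x => [|y s IHs] x.
  by rewrite path_sum_nil big1 // => i _; rewrite path_sum_nil mulr0.
rewrite path_sum_cons IHs -big_split; apply: eq_bigr => i _ /=.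
by rewrite path_sum_cons mulrDr.
Qed.

Section Dist.
Context (T : wtree R V).

Lemma path_weight_ge0 x s : path (edge T) x s -> 0 <= path_sum (weight T) x s.
Proof.
move=> es; apply: le_trans (le_path_sum (f := fun _ _ => 0) _ es).
  by rewrite /path_sum big1.
exact: weight_ge0.
Qed.

Lemma dist_le x s :
  path (edge T) x s -> dist T x (last x s) <= path_sum (weight T) x s.
Proof.
move=> es; apply: ge_inf; last by exists s.
by exists 0 => _ [s' [es' _] <-]; apply: path_weight_ge0.
Qed.

Lemma le_dist x y b :
  (forall s, path (edge T) x s -> last x s = y -> b <= path_sum (weight T) x s) ->
  b <= dist T x y.
Proof.
(* Connectedness is essential: the infimum of an empty set would be 0 by default. *)
move=> le_b; apply: lb_le_inf => [|_ [s [es ls] <-]]; last exact: le_b.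
have /connectP[s es ->] := edge_connected T x y.
by exists (path_sum (weight T) x s), s.
Qed.

Lemma dist_edge x y : edge T x y -> dist T x y <= weight T x y.
Proof.
move=> exy; have := @dist_le x [:: y]; rewrite /= exy path_sum_cons path_sum_nil.
by rewrite addr0; apply.
Qed.

Lemma distxx x : dist T x x = 0.
Proof.
apply/eqP; rewrite eq_le; apply/andP; split.
  by have := @dist_le x [::] isT; rewrite path_sum_nil.
by apply: le_dist => s es _; apply: path_weight_ge0.
Qed.

Lemma dist_ge0 x y : 0 <= dist T x y.
Proof. by apply: le_dist => s es _; apply: path_weight_ge0. Qed.

Lemma tour_cost_ge0 r (t : tour V) : 0 <= tour_cost T r t.
Proof. by rewrite /tour_cost /path_sum sumr_ge0 // => a _; apply: dist_ge0. Qed.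

End Dist.
End PathSum.

(** * Cuts and the cost of a tour *)

(** The tree metric in cut form: the edge above u counts when it separates x from y. It depends on
    [p] and [w] alone, so trees with different edges can be compared through it. *)
Definition cut (R : realType) (V : finType) (r : V) (p : V -> V) (w : V -> R)
    (x y : V) : R :=
  \sum_(u | u != r) w u * (fconnect p x u != fconnect p y u)%:R.

(* A tour visiting x crosses the cut between the subtree of each ancestor of x
   and the rest at least twice. *)
Lemma tour_cost_ge (R : realType) (V : finType) (T : wtree R V) (r : V)
    (p : V -> V) (dep : V -> nat) (w : V -> R) (t : tour V) :
  rooted r p dep -> (forall v, v != r -> 0 <= w v) ->
  (forall x y, edge T x y -> cut r p w x y <= weight T x y) ->
  2 * (\sum_(u | (u != r) && has (fun x => fconnect p x u) (stops t)) w u) <=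
    tour_cost T r t.
Proof.
move=> rootedp w_ge0 cut_le.
pose chi u x y : R := (fconnect p x u != fconnect p y u)%:R.
have chi0 u x : chi u x x = 0 by rewrite /chi eqxx.
have chi_tri u x y z : chi u x z <= chi u x y + chi u y z.
  rewrite /chi -natrD ler_nat.
  by case: (fconnect p x u); case: (fconnect p y u); case: (fconnect p z u).
have cut_dist x y : cut r p w x y <= dist T x y.
  apply: le_dist => s es <-; apply: le_trans (le_path_sum cut_le es).
  rewrite path_sum_lin /cut; apply: ler_sum => u u_r.
  by rewrite ler_wpM2l ?w_ge0 //; apply: (path_sum_triangle (f := chi u)).
have {cut_dist}: path_sum (cut r p w) r (rcons (stops t) r) <= tour_cost T r t.
  by rewrite /tour_cost /path_sum ler_sum.
apply: le_trans; rewrite path_sum_lin mulr_sumr [leRHS](bigID (fun u =>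
  has (fun x => fconnect p x u) (stops t))) /= -[leLHS]addr0 lerD //; last first.
  apply: sumr_ge0 => u /andP[u_r _]; rewrite mulr_ge0 ?w_ge0 //.
  by rewrite /path_sum sumr_ge0.
apply: ler_sum => u /andP[u_r /hasP[x /splitPr[s1 s2] xu]].
rewrite mulrC ler_wpM2l ?w_ge0 //.
(* Split the tour at a stop x below u: u separates x from r, so each half crosses the cut. *)
rewrite rcons_cat rcons_cons -cat_rcons path_sum_cat last_rcons.
have ru : fconnect p r u = false by rewrite (fconnect_rootE rootedp) (negPf u_r).
have le1 := path_sum_triangle r (rcons s1 x) (chi0 u) (chi_tri u).
have le2 := path_sum_triangle x (rcons s2 r) (chi0 u) (chi_tri u).
rewrite !last_rcons in le1 le2.
apply: le_trans (lerD le1 le2).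
by rewrite /chi xu ru /=; lra.
Qed.

(* Grow an Euler tour node by node, splicing a detour to each new node v into
   the tour at its parent. *)
Lemma euler_tour (R : realType) (V : finType) (T : wtree R V) (r : V)
    (p : V -> V) (dep : V -> nat) (w : V -> R) (A : {set V}) :
  rooted r p dep -> (forall v, v != r -> 0 <= w v) ->
  (forall v, v != r -> dist T v (p v) <= w v /\ dist T (p v) v <= w v) ->
  r \notin A -> (forall v, v \in A -> p v \in r |: A) ->
  exists s : seq V, {subset A <= s} /\
    path_sum (dist T) r (rcons s r) <= 2 * \sum_(v in A) w v.
Proof.
move=> rootedp w_ge0 dist_w; have [n] := ubnP #|A|.
elim: n A => // n IHn A ltAn rA upA.
have [->|/set0Pn[v0 v0A]] := eqVneq A finset.set0.
  exists [::]; split => [x|]; first by rewrite inE.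
  by rewrite big_set0 mulr0 path_sum_cons path_sum_nil distxx addr0.
(* As [dep v] is maximal, v is the parent of no node of A, so A without v stays closed under
   parents. *)
case: (arg_maxnP dep v0A) => v vA0 maxv; have {vA0} vA : v \in A := vA0.
have v_r : v != r by apply: contraNneq rA => <-.
have pvv := rooted_dep rootedp v_r.
have pv_A : p v \in r |: A :\ v.
  by have := upA v vA; rewrite !inE (parent_neq rootedp v_r).
case: (IHn (A :\ v)) => [|||s [sA cost_s]].
- by move: ltAn; rewrite (cardsD1 v) vA.
- by rewrite !inE negb_and rA orbT.
- move=> u; rewrite !inE => /andP[uv uA]; have := upA u uA; rewrite !inE.
  have [->|pu_r /= ->] //= := eqVneq (p u) r; rewrite andbT.
  have u_r : u != r by apply: contraNneq rA => <-.
  apply/eqP => pu_v; have := maxv u uA.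
  by rewrite /= -pu_v leqNgt (rooted_dep rootedp).
have pv_s : p v \in r :: s.
  by move: pv_A; rewrite !inE => /orP[->//|pvA]; rewrite sA ?orbT // !inE.
case/splitPl: pv_s => s1 s2 ls1 in sA cost_s *.
exists (s1 ++ v :: p v :: s2); split => [x xA|].
  have [->|xv] := eqVneq x v; first by rewrite mem_cat mem_head orbT.
  have := sA x; rewrite !inE xv xA !mem_cat !inE => /(_ isT) /orP[->//|->].
  by rewrite !orbT.
rewrite (big_setD1 v vA) /= mulrDr; move: cost_s.
rewrite !rcons_cat !path_sum_cat !rcons_cons !path_sum_cons ls1.
have [] := dist_w v v_r.
lra.
Qed.

(** * Comparing optima *)

Section Solutions.
Context (R : realType) (V : finType) (r : V) (Q : nat) (demand : V -> nat).
Hypothesis Q_gt0 : (0 < Q)%N.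

(** One tour per unit of demand fits any positive capacity. *)
Lemma solution_exists : exists S : seq (tour V), solution r Q demand S.
Proof.
pose unit_tour v : tour V := ([:: v], [ffun u => nat_of_bool (u == v)]).
exists [seq unit_tour v | v <- enum V, _ <- iota 0 (demand v)]; split.
  move=> t /allpairsPdep[v [i [_ _ ->]]]; split => [u|].
    by rewrite /deliver /= ffunE; case: eqVneq => // ->; rewrite !inE eqxx orbT.
  rewrite (bigD1 v) //= big1 => [|u /negPf uv].
    by rewrite /deliver /= ffunE eqxx addn0.
  by rewrite /deliver /= ffunE uv.
move=> v; rewrite big_allpairs_dep /= big_enum /= (bigD1 v) //= [X in (_ + X)%N]big1.
  rewrite addn0 (eq_bigr (fun=> 1%N)) => [|i _].
    by rewrite sum1_size size_iota.
  by rewrite /deliver /= ffunE eqxx.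
move=> u uv; rewrite big1 // => i _.
by rewrite /deliver /= ffunE eq_sym (negPf uv).
Qed.

(** Each tour is rerouted separately and keeps its deliveries. *)
Lemma opt_le (T1 T2 : wtree R V) (c : R) : 0 < c ->
  (forall t : tour V, exists s : seq V, {subset stops t <= r :: s} /\
    path_sum (dist T2) r (rcons s r) <= c * tour_cost T1 r t) ->
  opt T2 r Q demand <= c * opt T1 r Q demand.
Proof.
move=> c_gt0 /choice[g gP]; rewrite -ler_pdivrMl //; apply: lb_le_inf.
  have [S solS] := solution_exists.
  by exists (\sum_(t <- S) tour_cost T1 r t), S.
move=> _ [S [okS demS] <-]; rewrite ler_pdivrMl // mulr_sumr.
pose g' t : tour V := (g t, t.2).
apply: (@le_trans _ _ (\sum_(t <- S) tour_cost T2 r (g' t))); last first.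
  by apply: ler_sum => t _; case: (gP t).
apply: ge_inf.
  by exists 0 => _ [S' _ <-]; apply: sumr_ge0 => t _; apply: tour_cost_ge0.
exists (map g' S); last by rewrite big_map.
split => [_ /mapP[t tS ->]|v]; last by rewrite big_map; apply: demS.
have [stop_t cap_t] := okS _ tS; split => // v /stop_t.
rewrite !inE => /orP[->//|/(gP t).1]; by rewrite inE.
Qed.

End Solutions.

(** Let A be the ancestors of the stops of a tour. The tour costs at least twice [w1] of A in T1,
    and an Euler tour of A in T2 at most twice [w2] of A; A is also closed under [p2]. Both
    directions of the theorem are instances. *)
Lemma opt_le_weights (R : realType) (V : finType) (r : V) (T1 T2 : wtree R V)
    (p p2 : V -> V) (dep : V -> nat) (w1 w2 : V -> R) (c : R)
    (Q : nat) (demand : V -> nat) :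
  rooted r p dep -> rooted r p2 dep ->
  (forall v, v != r -> 0 <= w1 v) -> (forall v, v != r -> 0 <= w2 v) ->
  (forall v, fconnect p v (p2 v)) ->
  (forall x y, edge T1 x y -> cut r p w1 x y <= weight T1 x y) ->
  (forall v, v != r -> dist T2 v (p2 v) <= w2 v /\ dist T2 (p2 v) v <= w2 v) ->
  0 < c ->
  (forall A : {set V}, r \notin A -> (forall v, v \in A -> p v \in r |: A) ->
     \sum_(v in A) w2 v <= c * \sum_(v in A) w1 v) ->
  (0 < Q)%N -> opt T2 r Q demand <= c * opt T1 r Q demand.
Proof.
move=> rootedp rootedp2 w1_ge0 w2_ge0 p2_anc cut_le dist_w2 c_gt0 le_w Q_gt0.
apply: opt_le => // t.
pose A := [set u | (u != r) && has (fun x => fconnect p x u) (stops t)].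
have rA : r \notin A by rewrite inE eqxx.
have upA u v : u \in A -> fconnect p u v -> v \in r |: A.
  rewrite !inE => /andP[_ /hasP[x xt xu]] uv.
  have [//|v_r /=] := eqVneq v r.
  by apply/hasP; exists x => //; apply: connect_trans xu uv.
have upA1 v : v \in A -> p v \in r |: A.
  by move=> /upA; apply; apply: fconnect1.
case: (euler_tour rootedp2 w2_ge0 dist_w2 rA) => [v vA|s [As cost_s]].
  exact: upA vA _.
exists s; split => [x xt|].
  rewrite inE; have [//|x_r /=] := eqVneq x r.
  by apply: As; rewrite inE x_r; apply/hasP; exists x.
apply: (le_trans cost_s); apply: (@le_trans _ _ (2 * (c * \sum_(v in A) w1 v))).
  by rewrite ler_pM2l ?ltr0n // le_w.
rewrite mulrCA ler_pM2l //.
have := tour_cost_ge t rootedp w1_ge0 cut_le.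
by under [X in _ -> _ * X <= _]eq_bigl => u do rewrite inE.
Qed.

(** * Recursion from the root and heavy paths *)

(** [dep] bounds the recursion depth, and any fuel of at least [dep v] gives the same value at v. *)
Lemma rooted_rec (V : finType) (r : V) (p : V -> V) (dep : V -> nat) (X : Type)
    (b : X) (F : V -> X -> X) :
  rooted r p dep ->
  exists f : V -> X, f r = b /\ forall v, v != r -> f v = F v (f (p v)).
Proof.
move=> rootedp.
pose fix f (n : nat) v {struct n} : X :=
  if v == r then b else if n is n'.+1 then F v (f n' (p v)) else b.
have fE n m v : (dep v <= n -> dep v <= m -> f n v = f m v)%N.
  elim: n m v => [|n IHn] [|m] v //=; have [//|v_r] := eqVneq v r;
    move: (rooted_dep rootedp v_r) => lt_v le_n le_m; try lia.
  by congr F; apply: IHn; lia.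
exists (fun v => f (dep v) v); split => [|v v_r].
  by case: (dep r) => [|n] /=; rewrite eqxx.
have lt_v := rooted_dep rootedp v_r.
case dep_v: (dep v) => [|n] /=; first by rewrite dep_v in lt_v.
by rewrite (negPf v_r); congr F; apply: fE; lia.
Qed.

Section Heavy.
Context (V : finType) (r : V) (p : V -> V) (dep : V -> nat).
Hypothesis rootedp : rooted r p dep.

Definition subtree (v : V) : {set V} := [set x | fconnect p x v].

(** Children of the depot are never heavy, so that the parent of a heavy node of an upward closed
    set A lies in A itself. *)
Definition heavy (v : V) : bool :=
  [&& v != r, p v != r & (#|subtree (p v)| < 2 * #|subtree v|)%N].

Lemma subtree_parent v : subtree v \subset subtree (p v).
Proof.
apply/fintype.subsetP => x; rewrite !inE => xv.
by apply: connect_trans xv _; apply: fconnect1.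
Qed.

(** The ancestors of a common descendant form a chain, so one sibling, say v, would be an ancestor
    of u, hence of [p u = p v], against [dep]. *)
Lemma subtree_disjoint u v :
  u != r -> v != r -> p u = p v -> u != v -> [disjoint subtree u & subtree v].
Proof.
move=> u_r v_r puv uv; rewrite -setI_eq0; apply/eqP/setP => x; rewrite !inE.
apply/negP => /andP[/iter_findex xu /iter_findex xv].
wlog le_uv : u v u_r v_r puv uv xu xv / (findex p x u <= findex p x v)%N.
  move=> H; case: (leqP (findex p x u) (findex p x v)) => [|/ltnW] le.
    exact: (H u v).
  by apply: (H v u) => //; rewrite eq_sym.
have : fconnect p u v.
  by rewrite -xv -(subnK le_uv) iterD xu fconnect_iter.
rewrite (fconnect_step p uv) puv => /(fconnect_dep rootedp).
by rewrite leqNgt (rooted_dep rootedp).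
Qed.

(** Two heavy siblings would have disjoint subtrees, each with more than half of the nodes below
    their parent. *)
Lemma heavy_inj u v : heavy u -> heavy v -> p u = p v -> u = v.
Proof.
move=> /and3P[u_r _ hu] /and3P[v_r _ hv] puv; apply/eqP/negPn/negP => uv.
have := subtree_disjoint u_r v_r puv uv; rewrite -leq_card_setU => /eqP cardU.
have : (#|subtree u :|: subtree v| <= #|subtree (p u)|)%N.
  by apply/subset_leq_card; rewrite finset.subUset {2}puv !subtree_parent.
by rewrite cardU; rewrite -puv in hv; lia.
Qed.

(* On the upward closed set A, each heavy path contributes the value of f at
   its deepest node in A. *)
Lemma sum_heavy_telescope (R : realType) (f : V -> R) (A : {set V}) :
  (forall v, 0 <= f v) -> (forall v, v \in A -> p v \in r |: A) ->
  0 <= \sum_(v in A) (f v - (heavy v)%:R * f (p v)).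
Proof.
move=> f_ge0 upA; rewrite sumrB subr_ge0.
rewrite (bigID heavy) /= [X in _ + X]big1 ?addr0; last first.
  by move=> v /andP[_ /negPf->]; rewrite mul0r.
rewrite (eq_bigr (fun v => f (p v))) => [|v /andP[_ ->]]; last by rewrite mul1r.
pose H := [set v in A | heavy v].
(* Distinct heavy nodes have distinct parents, all in A, so this is a part of the sum of [f] over
   A. *)
have -> : \sum_(v in A | heavy v) f (p v) = \sum_(u in [set p v | v in H]) f u.
  rewrite big_imset => [|u v]; last by rewrite !inE => /andP[_ ?] /andP[_ ?] /heavy_inj; apply.
  by apply: eq_bigl => v; rewrite inE.
rewrite [leRHS](big_setID [set p v | v in H]) /=.
rewrite (finset.setIidPr _) ?lerDl ?sumr_ge0 //.
apply/fintype.subsetP => _ /imsetP[v + ->]; rewrite inE => /andP[vA].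
by case/and3P=> _ pv_r _; have := upA v vA; rewrite !inE (negPf pv_r).
Qed.

(** A light step at least halves the subtree, except possibly the step out of the depot, which the
    factor 2 pays for. *)
Lemma light_count_le (lc : V -> nat) :
  lc r = 0%N -> (forall v, v != r -> lc v = lc (p v) + ~~ heavy v)%N ->
  forall v, (lc v <= trunc_log 2 (2 * #|V|))%N.
Proof.
move=> lc_r lc_S v; have V_gt0 : (0 < #|V|)%N by apply/card_gt0P; exists r.
have sub_gt0 u : (0 < #|subtree u|)%N by apply/card_gt0P; exists u; rewrite inE.
apply: trunc_log_max => //.
suff: (2 ^ lc v * #|subtree v| <= 2 * #|V|)%N.
  by apply: leq_trans; rewrite leq_pmulr.
elim/(rooted_ind rootedp): v => [|v v_r IHv].
  by rewrite lc_r mul1n (leq_trans (max_card _)) // leq_pmull.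
have le_sub := subset_leq_card (subtree_parent v).
rewrite lc_S // expnD; case: (boolP (heavy v)) => [_|].
  by rewrite muln1 (leq_trans _ IHv) // leq_mul2l le_sub orbT.
rewrite /heavy v_r /= negb_and negbK -leqNgt => /orP[/eqP pv_r|le2].
  by rewrite pv_r lc_r mul1n leq_mul2l max_card.
by rewrite -mulnA (leq_trans _ IHv) // leq_mul2l le2 orbT.
Qed.

End Heavy.

(** * Rehanging nodes from hubs *)

(** Supplies the cut and distance hypotheses of [opt_le_weights]: going from v to [q v] crosses no
    cut of nonzero weight except that of v. *)
Lemma parent_weight_bounds (R : realType) (V : finType) (T : wtree R V) (r : V)
    (p q : V -> V) (w : V -> R) :
  edge T =2 parent_edge r q ->
  (forall v, v != r -> 0 <= w v /\ weight T v (q v) = w v) ->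
  (forall v u, v != r -> u != r -> u != v -> w u != 0 ->
     fconnect p v u = fconnect p (q v) u) ->
  (forall x y, edge T x y -> cut r p w x y <= weight T x y) /\
  (forall v, v != r -> dist T v (q v) <= w v /\ dist T (q v) v <= w v).
Proof.
move=> edgeE wE step; split=> [x y|v v_r].
  have cut_q v : v != r -> cut r p w v (q v) <= weight T v (q v).
    move=> v_r; have [w_ge0 ->] := wE v v_r; rewrite /cut (bigD1 v) //= big1.
      by rewrite addr0 ler_piMr //; case: eqP.
    move=> u /andP[u_r uv]; have [->|wu] := eqVneq (w u) 0; first by rewrite mul0r.
    by rewrite (step v u) // eqxx mulr0.
  move=> exy; have := exy; rewrite edgeE => /orP[]/andP[nr /eqP eq_q].
    by rewrite -eq_q cut_q.
  rewrite weight_sym // -eq_q (le_trans _ (cut_q y nr)) // /cut.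
  by under eq_bigr do rewrite eq_sym.
have evq : edge T v (q v) by rewrite edgeE /parent_edge v_r eqxx.
have [_ <-] := wE v v_r; split; first exact: dist_edge.
by rewrite weight_sym // dist_edge // edge_sym.
Qed.

(** Only nodes that are not hubs are skipped between v and [q v], so cuts at hubs other than v do
    not notice the shortcut. *)
Lemma nearest_ancestor (V : finType) (r : V) (p : V -> V) (dep : V -> nat)
    (hub : pred V) :
  rooted r p dep -> hub r ->
  exists q : V -> V, [/\ rooted r q dep, forall v, fconnect p v (q v),
    forall v, hub (q v), forall v, v != r -> fconnect p (p v) (q v) &
    forall v u, v != r -> u != v -> hub u ->
      fconnect p v u = fconnect p (q v) u].
Proof.
move=> rootedp hub_r.
have [q [qr qE]] := rooted_rec r (fun v x => if hub (p v) then p v else x) rootedp.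
have q_anc v : fconnect p v (q v).
  elim/(rooted_ind rootedp): v => [|v v_r IHv]; first by rewrite qr.
  rewrite qE //; apply: connect_trans (fconnect1 _ _) _.
  by case: ifP.
have pq_anc v : v != r -> fconnect p (p v) (q v).
  by move=> v_r; rewrite qE //; case: ifP.
exists q; split => //.
- split=> // v v_r; apply: leq_ltn_trans (rooted_dep rootedp v_r).
  exact: (fconnect_dep rootedp (pq_anc v v_r)).
- elim/(rooted_ind rootedp) => [|v v_r IHv]; first by rewrite qr.
  by rewrite qE //; case: ifP.
- move=> v u + + hub_u; elim/(rooted_ind rootedp): v => [|v v_r IHv _ uv].
    by rewrite eqxx.
  rewrite (fconnect_step p) 1?eq_sym // qE //; case: ifP => // hub_pv; apply: IHv.
    by apply: contraFneq hub_pv => ->.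
  by apply: contraFneq hub_pv => <-.
Qed.

(* The depot has l = 0 and gets level 0, because ln 0 = 0. *)
Definition level (R : realType) (eps x : R) : nat :=
  Num.truncn (ln x / ln (1 + eps)).

(** * Rounding to powers of 1 + eps *)

Section Level.
Context (R : realType) (eps : R).
Hypothesis eps_gt0 : 0 < eps.

Lemma ln1D_gt0 : 0 < ln (1 + eps).
Proof. by rewrite ln_gt0 // ltrDl. Qed.

Lemma level_le x y : 0 < x -> x <= y -> (level eps x <= level eps y)%N.
Proof.
move=> x_gt0 le_xy; apply: le_truncn.
by rewrite ler_pM2r ?invr_gt0 ?ln1D_gt0 // ler_ln ?posrE // (lt_le_trans x_gt0).
Qed.

Lemma levelP x : 1 <= x ->
  (1 + eps) ^+ level eps x <= x <= (1 + eps) * (1 + eps) ^+ level eps x.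
Proof.
move=> x_ge1; have x_gt0 : 0 < x by apply: lt_le_trans x_ge1.
have a_gt0 : 0 < 1 + eps by rewrite addr_gt0.
have pow_gt0 k : 0 < (1 + eps) ^+ k by apply: exprn_gt0.
have q_ge0 : 0 <= ln x / ln (1 + eps).
  by rewrite divr_ge0 ?ln_ge0 // lerDl ltW.
have /andP[lo hi] := truncn_itv q_ge0.
rewrite -exprS; apply/andP; split.
  rewrite -ler_ln ?posrE ?pow_gt0 // lnXn // -mulr_natl.
  by rewrite -ler_pdivlMr ?ln1D_gt0.
rewrite -ler_ln ?posrE ?pow_gt0 // lnXn // -mulr_natl.
by rewrite -ler_pdivrMr ?ln1D_gt0 // ltW.
Qed.

Lemma level_bound x : 1 <= x -> (level eps x)%:R * ln (1 + eps) <= ln x.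
Proof.
move=> x_ge1; rewrite -ler_pdivlMr ?ln1D_gt0 // truncn_le.
by rewrite divr_ge0 ?ln_ge0 // lerDl ltW.
Qed.

End Level.

(** * The tree of low height *)

Lemma low_height_tree (R : realType) (V : finType) (r : V) (T : wtree R V)
    (eps W : R) :
  0 < eps -> 0 <= W -> (forall x y, edge T x y -> 1 <= weight T x y <= W) ->
  let K := level eps (#|V|%:R * W) in
  exists T' : wtree R V,
    (height T' r <= 2 * (trunc_log 2 (2 * #|V|) * K.+1 + K) + 1)%N /\
    forall (Q : nat) (demand : V -> nat), (0 < Q)%N ->
      opt T' r Q demand <= opt T r Q demand /\
      opt T r Q demand <= (1 + eps) * opt T' r Q demand.
Proof.
move=> eps_gt0 W_ge0 wT K.
have a_gt0 : 0 < 1 + eps by rewrite addr_gt0.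
have [p [dep [rootedp edgeE]]] := wtree_parent T r.
have edge_p v : v != r -> edge T v (p v).
  by move=> v_r; rewrite edgeE /parent_edge v_r eqxx.
pose w v := weight T v (p v).
have w_itv v : v != r -> 1 <= w v <= W by move/edge_p/wT.
have w_ge0 v : v != r -> 0 <= w v.
  by move=> /w_itv/andP[/(le_trans ler01)].
pose hv v := heavy r p v.
have hv_neq v : hv v -> (v != r) && (p v != r) by case/and3P=> -> ->.
(* [l v] is the distance to v from the parent of the top of its heavy path. *)
have [l [l_r lE]] := rooted_rec 0 (fun v x => w v + (hv v)%:R * x) rootedp.
have l_ge0 v : 0 <= l v.
  elim/(rooted_ind rootedp): v => [|v v_r IHv]; first by rewrite l_r.
  by rewrite lE // addr_ge0 ?w_ge0 ?mulr_ge0.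
have l_ge1 v : v != r -> 1 <= l v.
  move=> v_r; rewrite lE //; have /andP[w1 _] := w_itv v v_r.
  by rewrite (le_trans w1) // lerDl mulr_ge0.
have l_le v : l v <= #|V|%:R * W.
  (* The induction needs the sharper bound by W times the number of ancestors of v, itself
     included. *)
  apply: (@le_trans _ _ (#|[set u | fconnect p v u]|%:R * W)); last first.
    by rewrite ler_wpM2r // ler_nat max_card.
  elim/(rooted_ind rootedp): v => [|v v_r IHv]; first by rewrite l_r mulr_ge0.
  rewrite lE //; have /andP[_ wW] := w_itv v v_r.
  have lt_anc : (#|[set u | fconnect p (p v) u]| < #|[set u | fconnect p v u]|)%N.
    apply/proper_card/properP; split.
      by apply/fintype.subsetP => u; rewrite !inE; apply: connect_trans (fconnect1 _ _).
    exists v; rewrite !inE //; apply/negP => /(fconnect_dep rootedp).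
    by rewrite leqNgt (rooted_dep rootedp).
  apply: (@le_trans _ _ (W + #|[set u | fconnect p (p v) u]|%:R * W)).
    rewrite lerD // (le_trans _ IHv) // ler_piMl //; by case: (hv v).
  by rewrite -{1}[W]mul1r -mulrDl ler_wpM2r // nat1r ler_nat.
pose lev v := level eps (l v).
have lev_r : lev r = 0%N.
  by rewrite /lev /level l_r ln0 // mul0r truncn0.
have lev_K v : (lev v <= K)%N.
  have [->|v_r] := eqVneq v r; first by rewrite lev_r.
  by apply: level_le => //; apply: lt_le_trans (l_ge1 v v_r).
have lev_heavy v : hv v -> (lev (p v) <= lev v)%N.
  move=> hvv; have /andP[v_r pv_r] := hv_neq v hvv.
  apply: level_le => //; first exact: lt_le_trans (l_ge1 _ pv_r).
  by rewrite (lE v) // hvv mul1r lerDr w_ge0.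
(* At the depot l is 0, so the power of level 0, which is 1, would be too large. *)
pose rho v : R := if v == r then 0 else (1 + eps) ^+ lev v.
have rho_itv v : rho v <= l v <= (1 + eps) * rho v.
  rewrite /rho; case: eqVneq => [->|v_r]; first by rewrite l_r mulr0 lexx.
  by apply: levelP => //; apply: l_ge1.
(* [w'] arises from [rho] as [w] does from [l]. *)
pose w' v := rho v - (hv v)%:R * rho (p v).
have w'_ge0 v : v != r -> 0 <= w' v.
  move=> v_r; rewrite /w' /rho (negPf v_r); case: (boolP (hv v)) => [hvv|_].
    have /andP[_ /negPf->] := hv_neq v hvv.
    by rewrite mul1r subr_ge0 ler_weXn2l ?lev_heavy // lerDl ltW.
  by rewrite mul0r subr0 exprn_ge0 // ltW.
(* The hubs are the depot, the tops of heavy paths and the heavy nodes where the level jumps. *)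
pose hub v := hv v ==> (lev (p v) < lev v)%N.
have hub_r : hub r by rewrite /hub /hv /heavy eqxx.
have w'_hub v : w' v != 0 -> hub v.
  apply: contraNT; rewrite negb_imply -leqNgt => /andP[hvv le_lev].
  have /andP[/negPf v_r /negPf pv_r] := hv_neq v hvv.
  rewrite /w' /rho v_r pv_r hvv mul1r subr_eq0; apply/eqP; congr (_ ^+ _).
  by apply/eqP; rewrite eqn_leq le_lev lev_heavy.
have [q [rootedq q_anc hub_q pq_anc q_step]] := nearest_ancestor rootedp hub_r.
pose T' := parent_tree rootedq w'_ge0.
(* Both comparisons telescope: [w - w'] comes from [l - rho], and [(1 + eps) * w' - w] from
   [(1 + eps) * rho - l], which are nonnegative. *)
have le_w'w (A : {set V}) : r \notin A -> (forall v, v \in A -> p v \in r |: A) ->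
    \sum_(v in A) w' v <= 1 * \sum_(v in A) w v.
  move=> rA upA; rewrite mul1r -subr_ge0 -sumrB.
  have := sum_heavy_telescope rootedp (f := fun v => l v - rho v) _ upA.
  rewrite (eq_bigr (fun v => w v - w' v)) => [|v vA].
    by apply=> v; rewrite subr_ge0; case/andP: (rho_itv v).
  rewrite /w' (lE v) -/(hv v); last by apply: contraNneq rA => <-.
  by ring.
have le_ww' (A : {set V}) : r \notin A -> (forall v, v \in A -> p v \in r |: A) ->
    \sum_(v in A) w v <= (1 + eps) * \sum_(v in A) w' v.
  move=> rA upA; rewrite mulr_sumr -subr_ge0 -sumrB.
  have := sum_heavy_telescope rootedp (f := fun v => (1 + eps) * rho v - l v) _ upA.
  rewrite (eq_bigr (fun v => (1 + eps) * w' v - w v)) => [|v vA].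
    by apply=> v; rewrite subr_ge0; case/andP: (rho_itv v).
  rewrite /w' (lE v) -/(hv v); last by apply: contraNneq rA => <-.
  by ring.
case: (parent_weight_bounds (T := T) (p := p) (w := w) edgeE) => [v v_r|v u _ _ uv _|cutT distT].
- by split; rewrite ?w_ge0.
- by apply: fconnect_step; rewrite eq_sym.
case: (parent_weight_bounds (T := T') (r := r) (p := p) (q := q) (w := w'))
    => [//|v v_r|v u v_r _ uv wu|cutT' distT'].
- by split; [exact: (w'_ge0 v) | rewrite /= /parent_tree_weight v_r eqxx].
- exact: q_step (w'_hub u wu).
exists T'; split=> [|Q demand Q_gt0]; last first.
  split; last exact: (opt_le_weights _ rootedp rootedp w'_ge0 w_ge0 (fconnect1 p)
                       cutT' distT a_gt0 le_ww' Q_gt0).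
  rewrite -[leRHS]mul1r.
  exact: (opt_le_weights _ rootedp rootedq w_ge0 w'_ge0 q_anc cutT distT' ltr01 le_w'w Q_gt0).
have [lc [lc_r lcE]] := rooted_rec 0%N (fun v x => x + ~~ hv v)%N rootedp.
have lc_le := light_count_le rootedp lc_r lcE.
(* The pair of light count and level in lexicographic order, since levels are at most [K]: strictly
   increasing at hubs, weakly elsewhere. *)
pose g v := (lc v * K.+1 + lev v)%N.
have g_hub v : v != r -> hub v -> (g (p v) < g v)%N.
  move=> v_r; rewrite /g (lcE v) // /hub; case: (hv v) => /= [|_].
    by rewrite addn0 ltn_add2l.
  by have := lev_K (p v); rewrite mulnDl mul1n; lia.
have g_mono v : v != r -> (g (p v) <= g v)%N.
  move=> v_r; have [/(g_hub v v_r)/ltnW//|] := boolP (hub v).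
  rewrite negb_imply => /andP[hvv _].
  by rewrite /g (lcE v) // hvv addn0 leq_add2l lev_heavy.
(* The new parent is a hub. A node that is no hub may share its value of [g], and the extra 1
   separates them. *)
pose h v := (2 * g v + ~~ hub v)%N.
apply: (@height_parent_tree _ _ _ _ _ _ _ _ h) => [v v_r|v].
  rewrite /h hub_q addn0.
  have := fconnect_leq rootedp g_mono (pq_anc v v_r).
  have [/(g_hub v v_r)|_] := boolP (hub v); first by lia.
  by have := g_mono v v_r; lia.
rewrite /h leq_add ?leq_b1 // leq_mul2l /= leq_add ?lev_K //.
by rewrite leq_mul2r lc_le orbT.
Qed.

(** * Logarithmic estimates and the theorem *)

Lemma horner_le_monomial (R : realType) (P : {poly R}) :
  exists2 C : R, 1 <= C & forall x, 1 <= x -> P.[x] <= C * x ^+ size P.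
Proof.
(* The summand 1 makes [ln C] nonnegative later. *)
exists (1 + \sum_(i < size P) `|P`_i|) => [|x x_ge1].
  by rewrite lerDl sumr_ge0.
have x_ge0 : 0 <= x by rewrite (le_trans ler01).
rewrite mulrDl -[leLHS]add0r lerD ?mulr_ge0 ?exprn_ge0 //.
rewrite horner_coef mulr_suml ler_sum // => i _.
apply: (@le_trans _ _ (`|P`_i| * x ^+ i)).
  by rewrite ler_wpM2r ?exprn_ge0 ?ler_norm.
by rewrite ler_wpM2l // ler_weXn2l // ltnW.
Qed.

(** This is [ln (1 + x) <= x] at [x = - (eps / (1 + eps))], where [1 + x] is the inverse of
    [1 + eps]. *)
Lemma ln1D_ge (R : realType) (eps : R) : 0 < eps -> eps / (1 + eps) <= ln (1 + eps).
Proof.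
move=> eps_gt0; have a_gt0 : 0 < 1 + eps by rewrite addr_gt0.
have := @le_ln1Dx R (- (eps / (1 + eps))).
have -> : 1 + - (eps / (1 + eps)) = (1 + eps)^-1 by field; rewrite gt_eqF.
rewrite lnV ?posrE // lerN2; apply.
by rewrite ltrN2 ltr_pdivrMr // mul1r ltrDr.
Qed.

Theorem theorem5 (R : realType) (P : {poly R}) (eps_max : R) :
  exists delta : R, 0 < delta /\
    forall (V : finType) (r : V) (T : wtree R V) (eps : R),
      (forall x y : V, edge T x y ->
         [/\ weight T x y \is a Num.int, 0 < weight T x y &
             weight T x y <= P.[#|V|%:R]]) ->
      0 < eps -> eps <= eps_max ->
      exists T' : wtree R V,
        (height T' r)%:R <= delta * (ln #|V|%:R) ^+ 2 / eps /\
        forall (Q : nat) (demand : V -> nat), (0 < Q)%N ->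
          opt T' r Q demand <= opt T r Q demand /\
          opt T r Q demand <= (1 + eps) * opt T' r Q demand.
Proof.
have [C C_ge1 P_le] := horner_le_monomial P.
pose E := `|eps_max|; pose a : R := (ln 2)^-1.
have ln2_gt0 : 0 < ln 2 :> R by rewrite ln_gt0 // ltr1n.
have a_gt0 : 0 < a by rewrite invr_gt0.
have E_ge0 : 0 <= E by apply: normr_ge0.
have lnC_ge0 : 0 <= ln C by apply: ln_ge0.
(* Chosen so that [K <= M * L / eps]: the second factor bounds the logarithm of n times [P.[n]] by a
   multiple of L, the first comes from [ln (1 + eps) >= eps / (1 + E)]. *)
pose M := (1 + E) * (1 + (size P)%:R + a * ln C).
have M_ge0 : 0 <= M.
  by rewrite mulr_ge0 ?addr_ge0 ?mulr_ge0 // ltW.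
have a_ge0 := ltW a_gt0.
(* The summands bound [b * (K + 1)], [K] and the final 1 of the height, each in units of
   [L ^+ 2 / eps]. *)
pose D := 2 * (2 * a * (M + a * E) + M * a) + a ^+ 2 * E.
have D_ge0 : 0 <= D.
  by do ![apply: addr_ge0 | apply: mulr_ge0]; rewrite ?sqr_ge0.
exists (D + 1); split; first exact: ltr_wpDl.
move=> V r T eps wT eps_gt0 eps_le.
have le_epsE : eps <= E by apply: le_trans eps_le (ler_norm _).
set n := #|V| in wT *; have n_gt0 : (0 < n)%N by apply/card_gt0P; exists r.
(* For a single node [ln 1 = 0] forces height 0, which T itself has. *)
have [n_le1|n_gt1] := leqP n 1.
  exists T; split=> [|Q demand Q_gt0]; last first.
    rewrite lexx; split => //; rewrite mulrDl mul1r lerDl mulr_ge0 ?(ltW eps_gt0) //.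
    apply: lb_le_inf => [|_ [S _ <-]].
      have [S solS] := solution_exists r demand Q_gt0.
      by exists (\sum_(t <- S) tour_cost T r t), S.
    by apply: sumr_ge0 => t _; apply: tour_cost_ge0.
  have -> : height T r = 0%N.
    apply/eqP; rewrite -leqn0; apply/bigmax_leqP => k _.
    by rewrite -ltnS (leq_trans (ltn_ord k)).
  by rewrite divr_ge0 ?(ltW eps_gt0) // mulr_ge0 ?sqr_ge0 // ler_wpDr.
set L := ln n%:R.
have n_ge1 : 1 <= n%:R :> R by rewrite ler1n.
have aL : 1 <= a * L.
  by rewrite mulrC ler_pdivlMr // mul1r ler_ln ?posrE ?ltr0n // ler_nat.
have {}wT x y : edge T x y -> 1 <= weight T x y <= P.[n%:R].
  move=> /wT[w_int w_gt0 ->]; rewrite andbT -[leRHS]gtr0_norm //.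
  by rewrite norm_intr_ge1 // gt_eqF.
(* The bound on the weights says something about [P] only if there is an edge; with two nodes, the
   one above some x is at hand. *)
have P_ge1 : 1 <= P.[n%:R].
  have [x xr] : exists x, x != r.
    apply/existsP; apply: contraLR n_gt1 => /existsPn all_r.
    rewrite -leqNgt /n -(card1 r); apply/subset_leq_card/fintype.subsetP => x _.
    by rewrite inE; apply/negPn/all_r.
  have [p [dep [rootedp edgeE]]] := wtree_parent T r.
  have /wT/andP[] : edge T x (p x) by rewrite edgeE /parent_edge xr eqxx.
  exact: le_trans.
have [T' [height_le opt_T']] := low_height_tree r eps_gt0 (le_trans ler01 P_ge1) wT.
exists T'; split => //; rewrite -/n in height_le.
set K := level _ _ in height_le; set b := trunc_log _ _ in height_le.
have L_gt0 : 0 < L by rewrite ln_gt0 // ltr1n.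
have b_le : b%:R <= 2 * a * L.
  have : (2 ^ b <= 2 * n)%N by apply: trunc_logP => //; rewrite muln_gt0.
  rewrite -(ler_nat R) natrX natrM -ler_ln ?posrE ?exprn_gt0 ?mulr_gt0 ?ltr0n //.
  rewrite lnXn // lnM ?posrE ?ltr0n // -[_ *+ b]mulr_natr -ler_pdivlMl // => /le_trans; apply.
  rewrite -/a -/L -mulrA mulrCA ler_pM2l //.
  suff : ln 2 <= L by lra.
  by rewrite ler_ln ?posrE ?ltr0n // ler_nat.
have K_le : K%:R <= M * L / eps.
  have nP_ge1 : 1 <= n%:R * P.[n%:R] by rewrite mulr_ege1.
  have := level_bound eps_gt0 nP_ge1; rewrite -/K => K_ln.
  have ln_nP : ln (n%:R * P.[n%:R]) <= (1 + (size P)%:R + a * ln C) * L.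
    have le_nP : n%:R * P.[n%:R] <= n%:R * (C * n%:R ^+ size P).
      by rewrite ler_wpM2l ?ler0n // P_le.
    rewrite -(ler_ln) ?posrE ?(lt_le_trans ltr01) // in le_nP; last first.
      by rewrite mulr_ege1 // mulr_ege1 // exprn_ege1.
    apply: le_trans le_nP _.
    have C_gt0 : 0 < C by apply: lt_le_trans C_ge1.
    rewrite !lnM ?posrE ?mulr_gt0 ?exprn_gt0 ?ltr0n // lnXn ?ltr0n // -/L -mulr_natl.
    by have := ler_wpM2l lnC_ge0 aL; lra.
  have eps_ln : eps / (1 + E) <= ln (1 + eps).
    apply: le_trans (ln1D_ge eps_gt0).
    by rewrite ler_pM2l // lef_pV2 ?lerD2l // posrE ltr_pwDl // ltW.
  rewrite ler_pdivlMr // /M -mulrA -ler_pdivrMl ?ltr_pwDl //.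
  rewrite mulrCA [_^-1 * _]mulrC.
  apply: le_trans ln_nP; apply: le_trans K_ln.
  by rewrite ler_wpM2l.
(* With [1 <= a * L], this absorbs lower-order terms into multiples of [L ^+ 2 / eps]. *)
have one_le : 1 <= E / eps by rewrite ler_pdivlMr // mul1r.
set ie := eps^-1 in K_le one_le *.
have ie_gt0 : 0 < ie by rewrite invr_gt0.
apply: (@le_trans _ _ (2 * (b%:R * (K%:R + 1) + K%:R) + 1)).
  by move: height_le; rewrite -(ler_nat R) -[K.+1]addn1 !(natrD, natrM).
have aLE : 1 <= a * L * (E * ie) by rewrite mulr_ege1.
have K1_le : K%:R + 1 <= (M + a * E) * L * ie by lra.
have bK_le : b%:R * (K%:R + 1) <= 2 * a * L * ((M + a * E) * L * ie).
  by rewrite ler_pM // addr_ge0.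
have K_le2 : K%:R <= M * L * ie * (a * L).
  by rewrite (le_trans K_le) // ler_peMr // mulr_ge0 ?(ltW ie_gt0) // mulr_ge0 // ltW.
have one_le2 : 1 <= a * L * (a * L * (E * ie)) by rewrite mulr_ege1.
have : 0 <= L ^+ 2 * ie by rewrite mulr_ge0 ?sqr_ge0 // ltW.
rewrite /D; lra.
Qed.
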